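(* Let $\mathbb{Q}_0=\mathcal{Q}_0$ and $J\in\mathbb{N}$. For $j=1,\dots,J$, let $\mathbb{M}_{j-1}\subset\mathbb{Q}_{j-1}$ be an arbitrary subset of marked cells, and let $\mathbb{Q}_j$ be the mesh obtained from $\mathbb{Q}_{j-1}$ by refining the cells given by the output of the algorithm weakly_admissible_marking_recursive (described in the context) applied to $(\mathbb{Q}_{j-1},\mathbb{M}_{j-1})$. Then $$\#\mathbb{Q}_J-\#\mathbb{Q}_0\le C\sum_{j=0}^{J-1}\#\mathbb{M}_j,$$ where $C\le 4(4\tilde C+1)^d$, with $\tilde C:=\tfrac32\sqrt d\,(2p+1)$, is a constant depending only on $d$ and on the polynomial degree $p$.
   Context: Fix integers $d\ge 1$, $p\ge 1$ and let $\Omega=\Omega_0=[0,1]^d$. For $\ell\in\mathbb{Z}$, $\mathcal{Q}^\infty_\ell$ is the set of closed cubes $2^{-\ell}(\mathbf{k}+[0,1]^d)$, $\mathbf{k}\in\mathbb{Z}^d$ (cells of level $\ell$); for $\ell\ge 0$, $\mathcal{Q}_\ell$ is the set of cells of level $\ell$ contained in $\Omega$. $\mathbf{B}^\infty_{\mathbf{p},\ell}$ is the set of cubes $\prod_{i=1}^d[\tfrac{k_i}{2^\ell},\tfrac{k_i+p+1}{2^\ell}]$, $\mathbf{k}\in\mathbb{Z}^d$. For $Q\in\mathcal{Q}^\infty_\ell$: $\mathrm{parent}(Q)$ is the unique cell of level $\ell-1$ containing $Q$; $\mathrm{children}(Q)$ is the set of cells of level $\ell+1$ contained in $Q$, and $\mathrm{children}(A)=\bigcup_{Q\in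 A}\mathrm{children}(Q)$ for a set $A$ of cells; $\widehat{Q}$ is the union of all $C\in\mathbf{B}^\infty_{\mathbf{p},\ell}$ with $Q\subset C$; and $\mathcal{N}_Q:=\bigcup\{\mathrm{parent}(Q^* ) : Q^*\in\mathcal{Q}^\infty_\ell,\ Q^*\subset\widehat{Q}\}$. For $Q\in\mathcal{Q}_\ell$, the support extension (the union of the supports, intersected with $\Omega$, of the tensor-product B-splines of level $\ell$, degree $p$ and maximum smoothness whose support contains $Q$) is $\tilde Q=\widehat Q\cap\Omega_0$. A hierarchy of subdomains of depth $n$ is $\{\Omega_0,\dots,\Omega_n\}$ with $\Omega=\Omega_0\supset\Omega_1\supset\dots\supset\Omega_{n-1}\supset\Omega_n=\emptyset$, where $\Omega_\ell$ is a union of cells of level $\ell-1$ for $\ell=1,\dots,n-1$. Its hierarchical mesh is $\mathbb{Q}:=\bigcup_{\ell=0}^{n-1}\{Q\in\mathcal{Q}_\ell : Q\subset\Omega_\ell,\ Q\not\subset\Omega_{\ell+1}\}$ (the set of active cells; $\#\mathbb{Q}$ is its cardinality). Put $\omega_\ell:=\bigcup\{Q\in\mathcal{Q}_\ell : \tilde Q\subset\Omega_\ell\}$. The initial mesh $\mathbb{Q}_0=\mathcal{Q}_0$ corresponds to the hierarchy $\{\Omega_0,\emptyset\}$ of depth $1$. For a union $B$ of cells, $\omega_\ell(B)$ denotes the set of cells $Q\in\mathcal{Q}_\ell$ with $Q\subset B$ and $\tilde Q\subset B$. Refinement. Given the mesh $\mathbb{Q}$ of a hierarchy of depth $n$ and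 $\hat{\mathbb{M}}=\{\hat{\mathcal{M}}_\ell\}_{\ell=0}^{n-1}$ with $\hat{\mathcal{M}}_\ell\subset\mathbb{Q}\cap\mathcal{Q}_\ell$, the refined mesh is the hierarchical mesh of $\{\Omega^*_0,\dots,\Omega^*_{n+1}\}$, where $\Omega_0^*:=\Omega_0$, $\Omega^*_\ell:=\Omega_\ell\cup\bigcup\{Q : Q\in\hat{\mathcal{M}}_{\ell-1}\}$ for $\ell=1,\dots,n$, and $\Omega^*_{n+1}:=\emptyset$. Algorithm weakly_admissible_marking_recursive$(\mathbb{Q},\mathbb{M})$, where $\mathbb{M}=\{\mathcal{M}_\ell\}_{\ell=0}^{n-1}$, $\mathcal{M}_\ell\subset\mathbb{Q}\cap\mathcal{Q}_\ell$: 1. (Update) For $\ell=n-1,\dots,1$ (in this order), split the current $\mathcal{M}_\ell$ into $\mathcal{M}^{\mathrm{OPT}}_\ell:=\{Q\in\mathcal{M}_\ell : Q\subset\omega_\ell\}$, $\mathcal{M}^{\mathrm{SUBOPT}}_\ell:=\{Q\in\mathcal{M}_\ell : Q\not\subset\omega_\ell,\ \mathrm{parent}(Q)\subset\omega_{\ell-1}\}$, $\mathcal{M}^{\mathrm{AUX}}_\ell:=\{Q\in\mathcal{M}_\ell : Q\not\subset\omega_\ell,\ \mathrm{parent}(Q)\not\subset\omega_{\ell-1}\}$, and replace $\mathcal{M}_{\ell-1}$ by $\mathcal{M}_{\ell-1}\cup\{\mathrm{parent}(Q) : Q\in\mathcal{M}^{\mathrm{AUX}}_\ell\}$. Then set $\mathcal{M}^{\mathrm{OPT}}_0:=\mathcal{M}_0$,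 $\mathcal{M}^{\mathrm{SUBOPT}}_0:=\emptyset$, $\mathcal{M}^{\mathrm{SUBOPT}}_n:=\emptyset$. 2. Start with $\hat{\mathbb{M}}=\{\hat{\mathcal{M}}_\ell\}_{\ell=0}^{n-1}$ all empty. For $\ell=n,\dots,1$ and for each $Q\in\mathrm{children}(\mathcal{M}^{\mathrm{OPT}}_{\ell-1})\cup\mathcal{M}^{\mathrm{SUBOPT}}_\ell$, set $\hat{\mathbb{M}}\leftarrow$ mark_recursive$(\mathbb{Q},Q,\hat{\mathbb{M}})$. Output $\hat{\mathbb{M}}$. Routine mark_recursive$(\mathbb{Q},Q,\hat{\mathbb{M}})$ for $Q\in\mathcal{Q}_\ell$: for each $Q_i\in\omega_\ell(\mathcal{N}_Q\cap\Omega_0)$ with $Q_i\not\subset\omega_{\ell-1}$, set $\hat{\mathbb{M}}\leftarrow$ mark_recursive$(\mathbb{Q},\mathrm{parent}(Q_i),\hat{\mathbb{M}})$; afterwards add to $\hat{\mathcal{M}}_{\ell-1}$ all $Q'\in\mathbb{Q}\cap\mathcal{Q}_{\ell-1}$ with $Q'\subset\mathcal{N}_Q$; return $\hat{\mathbb{M}}$. *)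

(* Defs.v *)
From mathcomp Require Import all_boot all_order all_algebra finmap.
From mathcomp Require Import all_classical all_reals.

Set Implicit Arguments.
Unset Strict Implicit.
Unset Printing Implicit Defensive.

Import Order.TTheory GRing.Theory Num.Theory.

Local Open Scope classical_set_scope.
Local Open Scope ring_scope.

(* The pair (l, k) encodes the closed cube 2^-l (k + [0,1]^d).  For d >= 1
   distinct pairs give distinct cubes, so counting pairs is counting cubes. *)
Definition cell (d : nat) : Type := (int * {ffun 'I_d -> int})%type.

(* [fset_set A] enumerates [A] when [A] is finite, and is empty otherwise;
   see [finite_cells] and [finite_mesh] below. *)
Definition ncard (T : choiceType) (A : set T) : nat := #|` fset_set A|%fset.

(* "For each x in A, set s <- f x s".  The order of the enumeration is that of
   [fset_set A].  It is immaterial in the algorithm, where every call adds to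
   the accumulator cells that do not depend on the accumulator. *)
Definition foreach (T : choiceType) (S : Type) (A : set T)
    (f : T -> S -> S) (s : S) : S :=
  foldl (fun s x => f x s) s (fset_set A).

Section HierarchicalMeshes.

Variables (R : realType) (d p : nat).

Local Notation point := 'rV[R]_d.
Local Notation cell := (cell d).

Definition Omega0 : set point := [set x | forall i, 0 <= x 0 i <= 1].

Definition level (Q : cell) : int := Q.1.

Definition cube (Q : cell) : set point :=
  [set x | forall i, (Q.2 i)%:~R * 2 ^ (- level Q) <= x 0 i
                     <= (Q.2 i + 1)%:~R * 2 ^ (- level Q)].

Definition cells (l : nat) : set cell :=
  [set Q | level Q = l%:Z /\ cube Q `<=` Omega0].

Definition box (l : int) (k : {ffun 'I_d -> int}) : set point :=
  [set x | forall i, (k i)%:~R * 2 ^ (- l) <= x 0 i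
                     <= (k i + p%:Z + 1)%:~R * 2 ^ (- l)].

(* The default value Q of [xget] is irrelevant: such a P always exists (and is
   unique for d >= 1). *)
Definition parent (Q : cell) : cell :=
  xget Q [set P | level P = level Q - 1 /\ cube Q `<=` cube P].

Definition children (A : set cell) : set cell :=
  [set C | exists2 Q, A Q & level C = level Q + 1 /\ cube C `<=` cube Q].

Definition hat (Q : cell) : set point :=
  \bigcup_(k in [set k | cube Q `<=` box (level Q) k]) box (level Q) k.

(* The set N_Q. *)
Definition nbh (Q : cell) : set point :=
  \bigcup_(Q' in [set Q' | level Q' = level Q /\ cube Q' `<=` hat Q])
    cube (parent Q').

Definition supp_ext (Q : cell) : set point := hat Q `&` Omega0.

(* [subdomain H l] is Omega_l, relevant for l <= depth H.  Nestedness and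
   the fact that Omega_l is a union of cells of level l - 1 hold for
   [initial] and are preserved by [refine] at markings of active cells. *)
Record hierarchy := Hierarchy {
  depth : nat;
  subdomain : nat -> set point }.

Definition initial : hierarchy :=
  Hierarchy 1 (fun l => if l == 0%N then Omega0 else set0).

Definition mesh (H : hierarchy) : set cell :=
  \bigcup_(l in `I_(depth H))
    [set Q | [/\ cells l Q, cube Q `<=` subdomain H l
               & ~ (cube Q `<=` subdomain H l.+1)]].

Definition omega (H : hierarchy) (l : nat) : set point :=
  \bigcup_(Q in [set Q | cells l Q /\ supp_ext Q `<=` subdomain H l]) cube Q.

(* The set of cells omega_l(B). *)
Definition omega_cells (l : nat) (B : set point) : set cell :=
  [set Q | [/\ cells l Q, cube Q `<=` B & supp_ext Q `<=` B]].

(* Families {M_l}_l of sets of cells, M_l consisting of cells of level l. *)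
Definition marking := nat -> set cell.

Definition add_cells (M : marking) (l : nat) (A : set cell) : marking :=
  fun k => if k == l then M k `|` A else M k.

Definition refine (H : hierarchy) (M : marking) : hierarchy :=
  Hierarchy (depth H).+1 (fun l =>
    if l is l'.+1 then
      if (l <= depth H)%N
      then subdomain H l `|` \bigcup_(Q in M l') cube Q
      else set0
    else subdomain H 0).

(* [l] is the level of [Q].  The recursion stops at l = 1, because omega_0 is
   all of Omega_0; the routine is never called with l = 0. *)
Fixpoint mark_recursive (H : hierarchy) (l : nat) (Q : cell) (Mhat : marking) :
    marking :=
  if l is l'.+1 then
    add_cells
      (foreach [set Qi | omega_cells l (nbh Q `&` Omega0) Qi /\
                         ~ (cube Qi `<=` omega H l')]
         (fun Qi M => mark_recursive H l' (parent Qi) M) Mhat)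
      l' [set Q' | [/\ mesh H Q', cells l' Q' & cube Q' `<=` nbh Q]]
  else Mhat.

Definition opt (H : hierarchy) (l : nat) (A : set cell) : set cell :=
  [set Q | A Q /\ cube Q `<=` omega H l].

Definition subopt (H : hierarchy) (l : nat) (A : set cell) : set cell :=
  [set Q | [/\ A Q, ~ (cube Q `<=` omega H l)
             & cube (parent Q) `<=` omega H l.-1]].

Definition aux (H : hierarchy) (l : nat) (A : set cell) : set cell :=
  [set Q | [/\ A Q, ~ (cube Q `<=` omega H l)
             & ~ (cube (parent Q) `<=` omega H l.-1)]].

Definition update (H : hierarchy) (M : marking) : marking :=
  foldl (fun M l => add_cells M l.-1 (parent @` aux H l (M l)))
    M (rev (iota 1 (depth H).-1)).

(* The split of M_l below is made on the final M_l: the update at level l only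
   changes M_(l-1), so that M_l is final when it is split. *)
Definition marked_opt (H : hierarchy) (M : marking) (l : nat) : set cell :=
  if l == 0%N then update H M 0%N else opt H l (update H M l).

Definition marked_subopt (H : hierarchy) (M : marking) (l : nat) : set cell :=
  if (l == 0%N) || (l == depth H) then set0 else subopt H l (update H M l).

Definition weakly_admissible_marking_recursive (H : hierarchy) (A : set cell) :
    marking :=
  let M : marking := fun l => A `&` cells l in
  foldl (fun Mhat l =>
      foreach (children (marked_opt H M l.-1) `|` marked_subopt H M l)
        (mark_recursive H l) Mhat)
    (fun=> set0) (rev (iota 1 (depth H))).

Lemma finite_cells (l : nat) : finite_set (cells l).
Proof.
pose f (k : {ffun 'I_d -> 'I_(2 ^ l)}) : cell :=
  (l%:Z, [ffun i => (k i : nat)%:Z]).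
apply: (@sub_finite_set _ _ (f @` setT)); last exact/finite_image/finite_finset.
move=> [m k] [/= lm sub].
rewrite /level /= in lm; rewrite {}lm {m} in sub *.
have e0 : 0 < (2 : R) ^ (- l%:Z) by exact: exprz_gt0.
have corner (b : bool) i : 0 <= (k i + b%:Z)%:~R * (2 : R) ^ (- l%:Z) <= 1.
  have /(_ _ i) := sub (\row_i ((k i + b%:Z)%:~R * 2 ^ (- l%:Z))).
  rewrite mxE; apply=> // j; rewrite mxE /level /=.
  by rewrite !ler_pM2r// !ler_int lerDl lerD2l; case: b.
have klt i : (`|k i|%N < 2 ^ l)%N /\ (`|k i|%N)%:Z = k i.
  have /andP[] := corner false i; rewrite addr0 pmulr_lge0// ler0z => k0 _.
  have /andP[_] := corner true i; rewrite -exprnN ler_pdivrMr ?exprn_gt0//.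
  rewrite mul1r -natrX -[(_ ^ _)%N%:R]mulrz_nat ler_int lezD1 => k1.
  by split; [rewrite -ltz_nat gez0_abs// (lt_le_trans k1)// -natz|rewrite gez0_abs].
exists [ffun i => Ordinal (klt i).1] => //.
by rewrite /f; congr pair; apply/ffunP => i; rewrite !ffunE /= (klt i).2.
Qed.

Lemma finite_mesh (H : hierarchy) : finite_set (mesh H).
Proof.
apply: bigcup_finite => [|l _]; first exact: finite_II.
by apply: sub_finite_set (finite_cells l) => Q [].
Qed.

End HierarchicalMeshes.

(* Main.v *)
Require Import Defs.
From mathcomp Require Import all_boot all_order all_algebra finmap.
From mathcomp Require Import all_classical all_reals.
From mathcomp Require Import zify ring lra.

Set Implicit Arguments.
Unset Strict Implicit.
Unset Printing Implicit Defensive.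

Import Order.TTheory GRing.Theory Num.Theory.

Local Open Scope classical_set_scope.
Local Open Scope ring_scope.

(** Distances between cells are measured between centers, in the maximum norm,
    and compared with the side of the cells.

    Every call of the marking routine moves by at most (p + 1/2) times the side
    of the current cell while going one level up, so that these moves form a
    geometric series: a cell Q refined at step j lies within (p + 1/2) sides
    of Q from some cell of M_j whose level is at least that of Q
    ([marking_near]).

    This alone does not bound the number of refined cells linearly, as one
    marked cell may cause refinements on all coarser levels.  The refined cells
    are therefore paid for jointly by all marked cells: a marked cell m gives
    [share Q m] = 2^(level Q - level m) to every Q that is not finer than m and
    lies within r = 2 p + 3/2 sides of Q from m.
    - A marked cell spends at most 2 (4 p + 4)^d, because on each level the
      number of cells in that range is at most (4 p + 4)^d, and the shares decay
      geometrically towards the coarse levels ([sum_share]).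
    - Each refined cell Q receives at least 1/2 ([funding_refined]).  If the
      marked cell m responsible for Q is finer than Q, then m was created by
      refining its parent at an earlier step, for which an earlier marked cell
      is responsible, and so on back to a marked cell on the level of Q, which
      gives 1 if it is close enough.  If the chain strays too far from Q first,
      the links that were still close have total length at least r / 2 sides of
      Q, and since a link at m is at most r times the side of m, their shares
      add up to 1/2 ([funding_chain]).

    Hence at most 4 (4 p + 4)^d * \sum_j #M_j cells are ever refined.  No cell is
    refined twice, and each refinement replaces one cell by at most 2^d
    ([card_mesh_refined]); this gives the constant
    4 (2 (4 p + 4))^d = 4 (8 p + 8)^d, and 8 p + 8 <= 4 Ctilde + 1 when p >= 1
    and d >= 1. *)

(** * Cells and their centers *)

Section Geometry.

Variables (R : realType) (d p : nat).
Local Notation cell := (cell d).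

Definition side (l : int) : R := 2 ^ (- l).

Lemma side_gt0 l : 0 < side l.
Proof. exact: exprz_gt0. Qed.

Lemma side_pred l : side (l - 1) = 2 * side l.
Proof. by rewrite /side opprB expfzDr ?pnatr_eq0//. Qed.

Lemma side_succ l : side l = 2 * side (l + 1).
Proof. by rewrite -side_pred addrK. Qed.

Definition center (Q : cell) : 'rV[R]_d :=
  \row_i (((Q.2 i)%:~R + 1 / 2) * side (level Q)).

Definition near (r : R) (P Q : cell) : Prop :=
  forall i, `|center P 0 i - center Q 0 i| <= r.

Lemma near_sym r P Q : near r P Q -> near r Q P.
Proof. by move=> PQ i; rewrite distrC. Qed.

Lemma near_trans P Q T r s t :
  near r P Q -> near s Q T -> r + s <= t -> near t P T.
Proof.
move=> PQ QT rst i; apply: le_trans rst.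
by apply: le_trans (lerD (PQ i) (QT i)); rewrite ler_distD.
Qed.

Lemma near_le P Q r t : near r P Q -> r <= t -> near t P Q.
Proof. by move=> PQ rt i; apply: le_trans (PQ i) rt. Qed.

(** Centers have half-integer coordinates, so membership of a center in a cube
    with integer corners is a statement about integers.  This replaces all
    arguments on interiors of cubes. *)
Lemma int_le_half (a b : int) : a%:~R <= b%:~R + 1 / 2 :> R -> a <= b.
Proof.
move=> ab; rewrite -ltzD1 -(@ltr_int R) rmorphD/=; lra.
Qed.

Lemma int_half_le (a b : int) : b%:~R + 1 / 2 <= a%:~R :> R -> b < a.
Proof. by move=> ab; rewrite -(@ltr_int R); lra. Qed.

Lemma center_in Q : cube Q (center Q).
Proof.
move=> i; rewrite mxE !ler_pM2r ?side_gt0// rmorphD/=; lra.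
Qed.

Lemma center_same_level (P Q : cell) :
  level Q = level P -> cube P (center Q) -> Q = P.
Proof.
move=> lQP PQ; apply: injective_projections => //.
suff eQP i : Q.2 i = P.2 i by apply/ffunP => i; exact: eQP.
have := PQ i; rewrite mxE lQP !ler_pM2r ?side_gt0// => /andP[].
by move=> /int_le_half a /int_half_le b; lia.
Qed.

Lemma center_next_level (P Q : cell) i :
  level Q = level P + 1 -> cube P (center Q) ->
  2 * P.2 i <= Q.2 i <= 2 * P.2 i + 1.
Proof.
move=> lQP PQ; have := PQ i; rewrite mxE lQP /side.
rewrite -[2 ^ (- level P)]/(side (level P)) side_succ !mulrA !ler_pM2r ?side_gt0//.
rewrite -![_%:~R * 2](@intrM _ _ 2) => /andP[/int_le_half a /int_half_le b].
by lia.
Qed.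

(** The parent in terms of indices; it coincides with [parent], see [parentE]. *)
Definition halved (Q : cell) : cell :=
  (level Q - 1, [ffun i => (Q.2 i %/ 2)%Z]).

Lemma cube_halved (Q : cell) : cube (R := R) Q `<=` cube (halved Q).
Proof.
move=> x Qx i; have := Qx i.
rewrite /halved /= ffunE -/(side _) -/(side _) {2 4}/level/= side_pred => /andP[a b].
rewrite !mulrA -![_%:~R * 2](@intrM _ _ 2).
apply/andP; split; [apply: le_trans a|apply: (le_trans b)];
  rewrite ler_pM2r ?side_gt0// ler_int; lia.
Qed.

Lemma center_parent (P Q : cell) :
  level Q = level P + 1 -> cube P (center Q) -> halved Q = P.
Proof.
move=> lQP PQ; apply: injective_projections => /=; first by rewrite lQP addrK.
suff eQP i : (Q.2 i %/ 2)%Z = P.2 i by apply/ffunP => i; rewrite ffunE eQP.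
by have := center_next_level i lQP PQ; lia.
Qed.

Lemma parentE Q : parent R Q = halved Q.
Proof.
rewrite /parent; case: xgetP => [P _ [lP QP]|/(_ (halved Q))[]].
  by rewrite -(@center_parent P Q)//; [rewrite lP subrK | exact/QP/center_in].
by split=> //; exact: cube_halved.
Qed.

Lemma near_child (P Q : cell) :
  level Q = level P + 1 -> cube P (center Q) ->
  near (side (level Q) / 2) Q P.
Proof.
move=> lQP PQ i; have := center_next_level i lQP PQ.
rewrite !mxE lQP (side_succ (level P)).
have := side_gt0 (level P + 1); set h := side _ => h0.
rewrite -!(ler_int R) !rmorphD !rmorphM/= => /andP[a b].
by rewrite ler_norml; apply/andP; split; nra.
Qed.

Lemma level_parent (Q : cell) : level (parent R Q) = level Q - 1.
Proof. by rewrite parentE. Qed.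

Lemma near_parent Q : near (side (level Q) / 2) Q (parent R Q).
Proof.
apply: near_child; first by rewrite level_parent subrK.
by rewrite parentE; apply/cube_halved/center_in.
Qed.

(** The neighborhood N_Q extends p cells of the level of Q from Q, rounded
    outwards to cells twice as large: the centers of these larger cells are off
    the center of Q by at most p + 1/2 sides of Q. *)
Definition reach : R := p%:R + 1 / 2.

Lemma reach_ge : (1 <= p)%N -> 3 / 2 <= reach.
Proof. by move=> p_ge1; have : 1 <= p%:R :> R; [rewrite ler1n | rewrite /reach; lra]. Qed.

Lemma hat_index (Q T : cell) i :
  level T = level Q -> cube (R := R) T `<=` hat p Q ->
  Q.2 i - p%:Z <= T.2 i <= Q.2 i + p%:Z.
Proof.
move=> lTQ /(_ _ (center_in T))[k /(_ _ (center_in Q))/(_ i)].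
rewrite mxE !ler_pM2r ?side_gt0// => /andP[/int_le_half a /int_half_le b].
move=> /(_ i); rewrite mxE lTQ !ler_pM2r ?side_gt0//.
by move=> /andP[/int_le_half a' /int_half_le b']; lia.
Qed.

Lemma near_hat_parent (Q T : cell) :
  level T = level Q -> cube (R := R) T `<=` hat p Q ->
  near (reach * side (level Q)) (parent R T) Q.
Proof.
move=> lTQ TQ i; have := hat_index i lTQ TQ.
rewrite !mxE level_parent lTQ side_pred parentE /= ffunE.
have := side_gt0 (level Q); set h := side _ => h0 kb.
have /andP[] : T.2 i - 1 <= 2 * (T.2 i %/ 2)%Z <= T.2 i by lia.
move: kb; rewrite -!(ler_int R) !rmorphB !rmorphD !rmorphM/= => /andP[].
rewrite -pmulrn => a b a' b'.
by rewrite /reach ler_norml; apply/andP; split; nra.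
Qed.

(** The center of T lies in one of the cubes whose union is N_Q; as these cubes
    belong to the grid of T, that cube is T itself. *)
Lemma nbh_near (Q T : cell) :
  level T = level Q - 1 -> cube (R := R) T `<=` nbh p Q ->
  near (reach * side (level Q)) T Q.
Proof.
move=> lT /(_ _ (center_in T))[U [lU UQ] UT].
rewrite (@center_same_level (parent R U) T)// ?level_parent ?lU//.
exact: near_hat_parent.
Qed.

(** The parent of T is one of the cubes whose union is N_Q, so going up one level
    costs no more than staying inside N_Q. *)
Lemma nbh_parent_near (Q T : cell) :
  level T = level Q -> cube (R := R) T `<=` nbh p Q ->
  near (reach * side (level Q)) (parent R T) Q.
Proof.
move=> lT /(_ _ (center_in T))[U [lU UQ] UT].
rewrite [parent R T]parentE (@center_parent (parent R U) T)//.
  exact: near_hat_parent.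
by rewrite level_parent lU lT subrK.
Qed.

End Geometry.

(** * Cells marked by the algorithm *)

Section Algorithm.

Variables (R : realType) (d p : nat).
Local Notation cell := (cell d).
Local Notation near := (@near R d).
Local Notation side := (side R).
Local Notation reach := (reach R p).

Lemma foreach_ind (T : choiceType) (S : Type) (I : S -> Prop) (A : set T)
    (f : T -> S -> S) (s : S) :
  I s -> (forall x t, A x -> I t -> I (f x t)) -> I (foreach A f s).
Proof.
move=> Is If; rewrite /foreach.
have : forall x, x \in (fset_set A : seq T) -> A x.
  have [fA|infA] := pselect (finite_set A) => x.
    by rewrite in_fset_set// inE.
  by rewrite /fset_set; case: pselect.
elim: (fset_set A : seq T) s Is => //= x r IH s Is rA.
apply: IH => [|y yr]; last by apply: rA; rewrite inE yr orbT.
by apply: If => //; apply: rA; rewrite mem_head.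
Qed.

Lemma foldl_ind (T : eqType) (S : Type) (I : S -> Prop) (r : seq T)
    (f : S -> T -> S) (s : S) :
  I s -> (forall x t, x \in r -> I t -> I (f t x)) -> I (foldl f s r).
Proof.
elim: r s => //= x r IH s Is If; apply: IH => [|y t yr].
  by apply: If; rewrite ?mem_head.
by apply: If; rewrite inE yr orbT.
Qed.

Lemma level_cells (l : nat) (Q : cell) : cells R l Q -> level Q = l%:Z.
Proof. by case. Qed.

Definition marks_near (H : hierarchy R d) (l : nat) (Q : cell)
    (l' : nat) (Q' : cell) : Prop :=
  [/\ mesh H Q', cells R l' Q', (l' < l)%N
    & near (reach * (side l'%:Z - side l%:Z)) Q' Q].

(** A call at level i moves by at most [reach] sides of level i, and
    [reach * (side l' - side l)] is the sum of these bounds over the levels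
    i = l' + 1, ..., l. *)
Lemma mark_recursive_near (H : hierarchy R d) (l : nat) (Q : cell)
    (X : marking d) :
  level Q = l%:Z -> forall l' Q', mark_recursive p H l Q X l' Q' ->
  X l' Q' \/ marks_near H l Q l' Q'.
Proof.
elim: l Q X => [|l IH] Q X lQ l' Q' /=; first by left.
have lS : l.+1%:Z - 1 = l%:Z by lia.
have sS : side l%:Z = 2 * side l.+1%:Z by rewrite -lS side_pred.
rewrite {1}/add_cells.
set Y := foreach _ _ _.
have YX : forall l' Q', Y l' Q' -> X l' Q' \/ marks_near H l.+1 Q l' Q'.
  rewrite /Y; apply: (foreach_ind (I := fun Z => forall l' Q',
    Z l' Q' -> X l' Q' \/ marks_near H l.+1 Q l' Q')) => [k T XT|].
    by left.
  move=> Qi Z [[cQi nQi _] _] IZ k T /IH[].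
    - by rewrite level_parent (level_cells cQi).
    - exact: IZ.
  move=> [mT cT kl nT]; right; split=> //; first exact: ltnW.
  have nQi' : near (reach * side l.+1%:Z) (parent R Qi) Q.
    rewrite -lQ; apply: nbh_parent_near; last by move=> x /nQi[].
    by rewrite lQ (level_cells cQi).
  by apply: near_trans nT nQi' _; rewrite sS; lra.
case: eqP => [->|_]; last exact: YX.
case=> [/YX//|[mQ' cQ' nQ']]; right; split=> //.
apply: (@near_le _ _ _ _ (reach * side l.+1%:Z)); last by rewrite sS; lra.
by rewrite -lQ; apply: nbh_near => //; rewrite lQ lS (level_cells cQ').
Qed.

(** The cell m and its ancestors, described by the only properties used later: they are not
    finer than m, and their centers are off the center of m by at most half the
    difference of the sides. *)
Definition ancestor_near (A : set cell) (l : nat) (Q : cell) : Prop :=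
  level Q = l%:Z /\ exists m (k : nat),
    [/\ A m, level m = k%:Z, (l <= k)%N
      & near ((side l%:Z - side k%:Z) / 2) Q m].

Lemma update_ancestor (H : hierarchy R d) (A : set cell) l Q :
  update p H (fun l => A `&` cells R l) l Q -> ancestor_near A l Q.
Proof.
move: l Q; rewrite /update.
apply: (foldl_ind (I := fun X => forall l Q, X l Q -> ancestor_near A l Q))
  => [l Q [AQ cQ]|k X].
  have lQ := level_cells cQ.
  split=> //; exists Q, l; split=> // i.
  by rewrite !subrr mul0r normr0.
rewrite mem_rev mem_iota => /andP[k0 _] IX l Q; rewrite /add_cells.
case: eqP => [->|_]; last exact: IX.
case=> [|[T [/IX[lT [m [j [Am lm kj nT]]]] _ _] <-]]; first exact: IX.
have lS : k%:Z - 1 = k.-1%:Z by lia.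
split; first by rewrite level_parent lT lS.
exists m, j; split=> //; first by lia.
apply: near_trans (near_sym (near_parent R T)) nT _.
by rewrite lT -lS side_pred; lra.
Qed.

Hypothesis p_ge1 : (1 <= p)%N.

(** The cell m is responsible for the refinement of Q. *)
Definition marked_near (A : set cell) (l : nat) (Q : cell) : Prop :=
  exists m (k : nat), [/\ A m, level m = k%:Z, (l <= k)%N
    & near (reach * side l%:Z) Q m].

(** The recursion starts either at an ancestor of a marked cell, or at a child of
    one, hence within 3/2 of its own sides from the marked cell. *)
Lemma marking_near (H : hierarchy R d) (A : set cell) l Q :
  weakly_admissible_marking_recursive p H A l Q ->
  [/\ mesh H Q, cells R l Q & marked_near A l Q].
Proof.
move: l Q; rewrite /weakly_admissible_marking_recursive.
pose I (X : marking d) := forall l Q, X l Q ->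
  [/\ mesh H Q, cells R l Q & marked_near A l Q].
apply: (foldl_ind (I := I)) => [//|l X].
rewrite mem_rev mem_iota => /andP[l0 _] IX.
apply: (foreach_ind (I := I)) => // T Y sT IY l' Q'.
have [lT [m [k [Am lm lk nT]]]] : level T = l%:Z /\ exists m (k : nat),
    [/\ A m, level m = k%:Z, (l.-1 <= k)%N & near (3 / 2 * side l%:Z) T m].
  case: sT => [[P optP [lTP TP]]|].
    have : ancestor_near A l.-1 P.
      apply: update_ancestor (H) _ _ _ _; move: optP; rewrite /marked_opt.
      by case: eqP => [->//|_ []].
    case=> lP [m [k [Am lm lk nP]]].
    have lT : level T = l%:Z by rewrite lTP lP; lia.
    split=> //; exists m, k; split=> //.
    apply: near_trans (near_child lTP (TP _ (center_in R T))) nP _.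
    have -> : l.-1%:Z = l%:Z - 1 by lia.
    by rewrite lT side_pred; have := side_gt0 R k%:Z; lra.
  rewrite /marked_subopt; case: ifP => // _ [/update_ancestor].
  case=> lT [m [k [Am lm lk nT]]] _ _; split=> //; exists m, k; split=> //.
    by lia.
  apply: near_le nT _.
  by have := side_gt0 R k%:Z; have := side_gt0 R l%:Z; lra.
(* The initial offset of 3/2 sides of level l is absorbed by the term
   [reach * side l] that the geometric series leaves unused. *)
case/(mark_recursive_near lT) => [|[mQ' cQ' l'l nQ']]; first exact: IY.
split=> //; exists m, k; split=> //; first by lia.
apply: near_trans nQ' nT _.
by have := side_gt0 R l%:Z; have := reach_ge R p_ge1; nra.
Qed.

End Algorithm.

(** * One refinement step *)

Section Refinement.

Variables (R : realType) (d : nat).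
Local Notation cell := (cell d).
Local Notation hierarchy := (hierarchy R d).

Definition well_formed (H : hierarchy) : Prop :=
  (forall l, (depth H <= l)%N -> subdomain H l = set0) /\
  forall l x, subdomain H l.+1 x -> exists P : cell,
    [/\ level P = l%:Z, cube P x & cube P `<=` subdomain H l.+1].

Definition refined (X : marking d) : set cell := [set Q | exists l, X l Q].

Definition marks_mesh (H : hierarchy) (X : marking d) : Prop :=
  forall l Q, X l Q -> mesh H Q /\ cells R l Q.

Lemma mesh_at (H : hierarchy) (l : nat) (Q : cell) : level Q = l%:Z ->
  mesh H Q -> [/\ (l < depth H)%N, cube Q `<=` subdomain H l
                & ~ (cube Q `<=` subdomain H l.+1)].
Proof.
move=> lQ [k kH [[lQ' _] sQ nQ]].
by have <- : k = l by move: lQ'; rewrite lQ => -[].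
Qed.

Lemma mesh_cells (H : hierarchy) (Q : cell) :
  mesh H Q -> exists l, cells R l Q.
Proof. by case=> l _ [cQ _ _]; exists l. Qed.

Lemma well_formed_initial : well_formed (initial R d).
Proof. by split=> [[|l]|l x []]. Qed.

Lemma well_formed_refine (H : hierarchy) (X : marking d) :
  well_formed H -> marks_mesh H X -> well_formed (refine H X).
Proof.
move=> [H0 HU] HX; split=> [[|l]//= Hl|l x /=]; first by rewrite leqNgt Hl.
case: ifP => // _ [/HU[P [lP Px PH]]|[P XP Px]].
  by exists P; split=> // y /PH; left.
exists P; split=> //; first exact: level_cells (HX _ _ XP).2.
by move=> y Py; right; exists P.
Qed.

Lemma subdomain_refine (H : hierarchy) (X : marking d) l :
  well_formed H -> subdomain H l `<=` subdomain (refine H X) l.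
Proof.
move=> [H0 _]; case: l => [//|l] x /=.
case: ifP => [_ Hx|/negbT]; first by left.
by rewrite -leqNgt => /leqW/H0 ->.
Qed.

Lemma cube_refined (H : hierarchy) (X : marking d) l Q :
  marks_mesh H X -> X l Q -> cube Q `<=` subdomain (refine H X) l.+1.
Proof.
move=> HX XQ; have [mQ cQ] := HX _ _ XQ.
have [lH _ _] := mesh_at (level_cells cQ) mQ.
by move=> x Qx /=; rewrite lH; right; exists Q.
Qed.

(** A cell Q of the new mesh that was not active before is not contained in the
    old subdomain of its level l.  That subdomain is a union of cells of level
    l - 1, so the center of Q is outside it too; the center is then in a
    refined cell, which must be the parent of Q. *)
Lemma mesh_refine (H : hierarchy) (X : marking d) Q :
  well_formed H -> marks_mesh H X -> mesh (refine H X) Q ->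
  mesh H Q \/ refined X (parent R Q).
Proof.
move=> [H0 HU] HX [l _ [cQ sQ nQ]].
have lQ := level_cells cQ.
have [sH|nH] := pselect (cube Q `<=` subdomain H l).
  left; exists l; last split=> //.
    rewrite /= ltnNge; apply/negP => /H0 Hl.
    by have := sH _ (center_in R Q); rewrite Hl.
  by apply: contra_not nQ => QH x /QH; exact: subdomain_refine.
right; case: l => [|l] in cQ sQ nQ lQ nH *; first exact: False_ind (nH sQ).
have par P : level P = l%:Z -> cube P (center R Q) -> parent R Q = P.
  move=> lP PQ; rewrite parentE; apply: center_parent PQ.
  by rewrite lQ lP; lia.
have := sQ _ (center_in R Q) => /=; case: ifP => // _ [|[P XP PQ]].
  move=> /HU[P [lP PQ PH]]; exfalso; apply: nH => x Qx; apply: PH.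
  by rewrite -(par P)// parentE; exact: cube_halved.
by exists l; rewrite (par P)//; apply: level_cells (HX _ _ XP).2.
Qed.

End Refinement.

(** * Shares of refined cells in a marked cell *)

Section Counting.

Variables (R : realType) (d p : nat).
Local Notation cell := (cell d).
Local Notation near := (@near R d).
Local Notation side := (side R).

Lemma size_children (A B : seq cell) : uniq B ->
  (forall Q, Q \in B -> parent R Q \in A) -> (size B <= size A * 2 ^ d)%N.
Proof.
move=> uB BA.
pose g (Q : cell) := (halved Q, [ffun i => (Q.2 i %% 2)%Z == 1]).
have g_inj : injective g.
  move=> [l k] [l' k']; rewrite /g /halved /level/= => -[ll' /ffunP kk' /ffunP oo'].
  suff -> : k = k' by congr pair; lia.
  suff E i : k i = k' i by apply/ffunP => i; exact: E.
  by have := kk' i; have := oo' i; rewrite !ffunE; lia.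
rewrite -(size_map g).
have -> : (size A * 2 ^ d = size
    [seq (a, b) | a <- A, b <- enum {ffun 'I_d -> bool}])%N.
  by rewrite size_allpairs -cardE card_ffun card_bool card_ord.
apply: uniq_leq_size; first by rewrite map_inj_uniq.
move=> _ /mapP[Q QB ->]; apply/allpairsP; eexists (_, _); split=> /=; last by [].
  by rewrite -(parentE R); exact: BA.
by rewrite mem_enum.
Qed.

(** This is [2 * reach + 1 / 2].  It has two roles: it bounds one link of the
    chain in [funding_chain], in sides of the link's cell, namely 1/2 from the
    cell to its parent and [2 * reach] (that is, [reach] sides of the parent)
    from there to the next marked cell; and half of it exceeds [reach]. *)
Definition radius : R := 2 * p%:R + 3 / 2.

Lemma int_eq_mod (n : nat) (x y : int) : y - x <= n%:Z -> x - y <= n%:Z ->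
  `|(x %% n.+1%:Z)%Z|%N = `|(y %% n.+1%:Z)%Z|%N -> x = y.
Proof.
move=> yx xy /(congr1 Posz); rewrite !gez0_abs ?modz_ge0// => /eqP.
rewrite eqz_mod_dvd => /dvdzP[q qE].
have [q0|[q0|q0]] : q = 0 \/ 1 <= q \/ q <= -1 by lia.
- by move: qE; rewrite q0; lia.
- nia.
- nia.
Qed.

(** Two of these cells have indices that differ by at most
    2 [radius] = 4 p + 3 in each coordinate, so that the indices modulo 4 p + 4
    determine the cell. *)
Lemma size_near (A : seq cell) (m : cell) (l : int) : uniq A ->
  (forall Q, Q \in A -> level Q = l /\ near (radius * side l) Q m) ->
  (size A <= (4 * p + 4) ^ d)%N.
Proof.
move=> uA Am; have N : (4 * p + 4 = (4 * p + 3).+1)%N by rewrite addnS.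
pose g (Q : cell) : {ffun 'I_d -> 'I_(4 * p + 3).+1} :=
  [ffun i => inord `|(Q.2 i %% (4 * p + 3).+1%:Z)%Z|%N].
have modlt (z : int) : (`|(z %% (4 * p + 3).+1%:Z)%Z| < (4 * p + 3).+1)%N by lia.
have g_inj : {in A &, injective g}.
  move=> Q T /Am[lQ nQ] /Am[lT nT] /ffunP gE.
  apply: injective_projections; first by rewrite -/(level Q) lQ -lT.
  suff E i : Q.2 i = T.2 i by apply/ffunP => i; exact: E.
  have := near_trans nQ (near_sym nT) (lexx _) i.
  rewrite !mxE lQ lT -mulrBl normrM (gtr0_norm (side_gt0 R l)) -mulrDl.
  rewrite ler_pM2r ?side_gt0// ler_norml => /andP[a b].
  have /(congr1 val) := gE i; rewrite !ffunE /= !inordK//.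
  apply: int_eq_mod; rewrite -(ler_int R) rmorphB/= -pmulrn natrD natrM;
    by move: a b; rewrite /radius; lra.
rewrite N -(size_map g).
apply: (@leq_trans #|{ffun 'I_d -> 'I_(4 * p + 3).+1}|); last first.
  by rewrite card_ffun !card_ord.
rewrite cardE; apply: uniq_leq_size; first by rewrite map_inj_in_uniq.
by move=> T _; rewrite mem_enum.
Qed.

(** The quotient of the sides is 2^(level Q - level m). *)
Definition share (Q m : cell) : R :=
  if (level Q <= level m) && `[< near (radius * side (level Q)) Q m >]
  then side (level m) / side (level Q) else 0.

Lemma share_ge0 Q m : 0 <= share Q m.
Proof. by rewrite /share; case: ifP => // _; rewrite divr_ge0// ltW ?side_gt0. Qed.

Lemma sum_inv_side (k : nat) :
  \sum_(l < k.+1) (side l%:Z)^-1 <= 2 / side k%:Z.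
Proof.
elim: k => [|k IH]; first by rewrite big_ord1 /side expr0z; lra.
rewrite big_ord_recr/=; move: IH.
have -> : side k%:Z = 2 * side k.+1%:Z by rewrite side_succ; congr (_ * side _); lia.
by rewrite invfM; lra.
Qed.

(** On each level l at most (4 p + 4)^d cells get 2^(l - k) each, and
    \sum_(l <= k) 2^(l - k) <= 2. *)
Lemma sum_share (A : seq cell) (m : cell) (k : nat) : uniq A ->
  (forall Q, Q \in A -> exists l : nat, level Q = l%:Z) -> level m = k%:Z ->
  \sum_(Q <- A) share Q m <= 2 * ((4 * p + 4) ^ d)%:R.
Proof.
move=> uA lA lm.
pose N : R := ((4 * p + 4) ^ d)%:R.
pose B (Q : cell) (l : nat) := (level Q == l%:Z)
  && `[< near (radius * side l%:Z) Q m >].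
have shareE Q : Q \in A ->
    share Q m <= \sum_(l < k.+1) (if B Q l then side k%:Z / side l%:Z else 0).
  have pos l : 0 <= if B Q l then side k%:Z / side l%:Z else 0.
    by case: ifP => // _; rewrite divr_ge0// ltW ?side_gt0.
  move=> /lA[l lQ]; rewrite /share lQ lm; case: ifP => [/andP[lk nQ]|_].
    have lk' : (l < k.+1)%N by lia.
    have BQ : B Q l by rewrite /B lQ eqxx nQ.
    rewrite (bigD1 (Ordinal lk'))//= BQ lerDl.
    by apply: sumr_ge0 => j _; exact: pos.
  by apply: sumr_ge0 => j _; exact: pos.
rewrite big_seq_cond; apply: le_trans.
  by apply: ler_sum => Q; rewrite andbT; exact: shareE.
rewrite -big_seq_cond exchange_big/=.
apply: (@le_trans _ _ (\sum_(l < k.+1) (side k%:Z / side l%:Z * N))).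
  apply: ler_sum => l _; rewrite -big_mkcond/= -big_filter big_const_seq count_predT.
  rewrite iter_addr_0 -[leLHS]mulr_natr ler_pM2l ?divr_gt0 ?side_gt0//.
  rewrite ler_nat; apply: (@size_near _ m l%:Z); first exact: filter_uniq.
  by move=> Q; rewrite mem_filter => /andP[/andP[/eqP -> /asboolP]].
rewrite -mulr_suml -mulr_sumr ler_wpM2r ?ler0n//.
have := sum_inv_side k; rewrite ler_pdivlMr ?side_gt0//.
by rewrite mulrC.
Qed.

End Counting.

(** * The sequence of meshes *)

Section RefinementSequence.

Variables (R : realType) (d p : nat) (p_ge1 : (1 <= p)%N).
Local Notation cell := (cell d).
Local Notation near := (@near R d).
Local Notation side := (side R).

Variables (J : nat) (H : nat -> hierarchy R d) (M : nat -> set cell).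

Let marks j := weakly_admissible_marking_recursive p (H j) (M j).

Hypothesis H0 : H 0%N = initial R d.
Hypothesis M_mesh : forall j, (j < J)%N -> M j `<=` mesh (H j).
Hypothesis HS : forall j, (j < J)%N -> H j.+1 = refine (H j) (marks j).

Lemma marks_meshP j : marks_mesh (H j) (marks j).
Proof. by move=> l Q /(marking_near p_ge1)[]. Qed.

Lemma well_formed_sequence j : (j <= J)%N -> well_formed (H j).
Proof.
elim: j => [_|j IH jJ]; first by rewrite H0; exact: well_formed_initial.
rewrite HS//; apply: well_formed_refine; last exact: marks_meshP.
exact/IH/ltnW.
Qed.

(** The cube of a refined cell of level l is contained in the subdomain of level
    l + 1 from then on, since subdomains only grow.  So no cell is refined
    twice. *)
Lemma refined_not_mesh i j Q : (i < j <= J)%N ->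
  refined (marks i) Q -> ~ mesh (H j) Q.
Proof.
move=> /andP[ij jJ] [l XQ].
suff sub : cube Q `<=` subdomain (H j) l.+1.
  have lQ := level_cells (marks_meshP XQ).2.
  by move=> /(mesh_at lQ)[_ _]; apply.
elim: j ij jJ => // j IH; rewrite ltnS leq_eqVlt => /orP[/eqP <-|ij] jJ.
  by rewrite HS//; apply: cube_refined XQ; exact: marks_meshP.
move=> x /(IH ij (ltnW jJ)) Qx; rewrite HS//.
by apply: subdomain_refine Qx; exact: well_formed_sequence (ltnW jJ).
Qed.

(** The initial mesh has level 0, so every finer cell was created at some step. *)
Lemma mesh_origin j Q (l : nat) : (j <= J)%N -> level Q = l.+1%:Z ->
  mesh (H j) Q -> exists2 i, (i < j)%N & refined (marks i) (parent R Q).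
Proof.
elim: j => [_ lQ|j IH jJ lQ].
  by rewrite H0 => /(mesh_at lQ)[].
rewrite HS// => /mesh_refine[||/(IH (ltnW jJ) lQ)[i ij XQ]|XQ].
- exact: well_formed_sequence (ltnW jJ).
- exact: marks_meshP.
- by exists i => //; exact: ltnW.
- by exists j.
Qed.

Definition all_refined j : set cell := \bigcup_(i in `I_j) refined (marks i).

Lemma finite_refined i : finite_set (refined (marks i)).
Proof.
by apply: sub_finite_set (finite_mesh (H i)) => Q [l /marks_meshP[]].
Qed.

Lemma finite_all_refined j : finite_set (all_refined j).
Proof.
by apply: bigcup_finite => [|i _]; [exact: finite_II|exact: finite_refined].
Qed.

Lemma card_mesh_refined j : (j <= J)%N ->
  (ncard (mesh (H j)) + ncard (all_refined j) <=
   ncard (mesh (H 0%N)) + ncard (all_refined j) * 2 ^ d)%N.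
Proof.
elim: j => [_|j IH jJ].
  by rewrite /all_refined II0 bigcup_set0 /ncard fset_set0 cardfs0.
have {IH} := IH (ltnW jJ).
rewrite /ncard.
set m := fset_set (mesh (H j)); set a := fset_set (all_refined j).
set r := fset_set (refined (marks j)).
have rP Q : Q \in r -> refined (marks j) Q.
  by rewrite in_fset_set ?inE//; exact: finite_refined.
have aE : fset_set (all_refined j.+1) = (a `|` r)%fset.
  rewrite /all_refined IIS bigcup_setU bigcup_set1 fset_setU//.
    exact: finite_all_refined.
  exact: finite_refined.
have rm : (r `<=` m)%fset.
  apply/fsubsetP => Q /rP[l /marks_meshP[mQ _]].
  by rewrite in_fset_set ?inE//; exact: finite_mesh.
have ar : (a `&` r = fset0)%fset.
  apply/fsetP => Q; rewrite !inE; apply/negP => /andP[Qa /rP[l /marks_meshP[mQ _]]].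
  move: Qa; rewrite in_fset_set ?inE; last exact: finite_all_refined.
  case=> i ij Xi; apply: refined_not_mesh Xi mQ.
  by rewrite (ltnW jJ) andbT.
(* Cells of the new mesh outside [m `\` r] have their parent in r. *)
have mS : (#|` fset_set (mesh (H j.+1))| <= (#|` m| - #|` r|) + #|` r| * 2 ^ d)%N.
  set m' := fset_set _.
  have -> : #|` m'| = (#|` (m' `&` (m `\` r))%fset| +
                       #|` (m' `\` (m `\` r))%fset|)%N.
    by rewrite cardfsID.
  apply: leq_add.
    rewrite -(cardfsDS rm); apply: fsubset_leq_card; exact: fsubsetIr.
  apply: (@size_children R) => [|Q]; first exact: fset_uniq.
  rewrite !inE negb_and negbK => /andP[Qmr].
  rewrite in_fset_set ?inE; last exact: finite_mesh.
  move=> mQ; have jJ1 : (j < j.+1 <= J)%N by rewrite ltnSn jJ.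
  rewrite in_fset_set ?inE; last exact: finite_refined.
  move: (mQ); rewrite HS// => /mesh_refine[||mjQ|//].
  - exact: well_formed_sequence (ltnW jJ).
  - exact: marks_meshP.
  case/orP: Qmr => [/rP XQ|/negP[]]; first by case: (refined_not_mesh jJ1 XQ).
  by rewrite in_fset_set ?inE//; exact: finite_mesh.
have rm' := fsubset_leq_card rm.
have ua : #|` (a `|` r)%fset| = (#|` a| + #|` r|)%N.
  by rewrite cardfsU ar cardfs0 subn0.
rewrite aE ua mulnDl; lia.
Qed.

(** What Q receives from the cells marked in the first j steps, a cell being
    counted once for each step at which it is marked. *)
Definition funding j (Q : cell) : R :=
  \sum_(0 <= i < j) \sum_(m <- fset_set (M i)) share R p Q m.

Lemma funding_mono i j Q : (i <= j)%N -> funding i Q <= funding j Q.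
Proof.
move=> ij; rewrite /funding (big_cat_nat (leq0n i) ij)//= lerDl.
by do 2![apply: sumr_ge0 => ? _]; exact: share_ge0.
Qed.

Lemma funding_ge0 j Q : 0 <= funding j Q.
Proof. by do 2![apply: sumr_ge0 => ? _]; exact: share_ge0. Qed.

Lemma finite_marked i : (i < J)%N -> finite_set (M i).
Proof. by move=> /M_mesh sub; apply: sub_finite_set sub (finite_mesh (H i)). Qed.

Lemma fundingS_share i Q m : (i < J)%N -> M i m ->
  funding i Q + share R p Q m <= funding i.+1 Q.
Proof.
move=> iJ Mm; rewrite /funding big_nat_recr//= lerD2l.
have mM : m \in fset_set (M i) by rewrite in_fset_set ?inE//; exact: finite_marked.
rewrite (big_fsetD1 m)//= lerDl.
by apply: sumr_ge0 => ? _; exact: share_ge0.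
Qed.

(** Here e is the amount that the chain starting at m must still deliver, and
    the distance allowed between Q and m decreases by [radius * side L] per unit
    of e.  The share of m lowers the demand on the rest of the chain, and the
    distance to the next link is at most what this lowering allows. *)
Lemma funding_chain (Q : cell) (L : nat) : level Q = L%:Z ->
  forall i m (k : nat) e, (i < J)%N -> M i m -> level m = k%:Z -> (L <= k)%N ->
  e <= 1 / 2 -> near (radius R p * (1 - e) * side L%:Z) Q m ->
  e <= funding i.+1 Q.
Proof.
move=> lQ i; elim/ltn_ind: i => i IH m k e iJ Mm lm Lk e2 nm.
have sL := side_gt0 R L%:Z; have sk := side_gt0 R k%:Z.
have r0 : 0 < radius R p by rewrite /radius; have := ler0n R p; lra.
have [e0|e0] := leP e 0; first exact: le_trans e0 (funding_ge0 _ _).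
have wE : share R p Q m = side k%:Z / side L%:Z.
  rewrite /share lQ lm; case: ifP => //; case/negP; apply/andP; split; first by lia.
  by apply/asboolP; apply: near_le nm _; rewrite ler_pM2r//; nra.
apply: le_trans (fundingS_share Q iJ Mm); rewrite wE.
have [kL|Lk'] : k = L \/ (L < k)%N by lia.
  by rewrite kL divff ?gt_eqF//; have := funding_ge0 i Q; lra.
rewrite -lerBlDr.
case: k => [//|k] in lm Lk wE Lk' sk *.
have := mesh_origin (ltnW iJ) lm (M_mesh iJ Mm).
case=> i' i'i [l XP].
have i'J : (i' < J)%N by exact: ltn_trans iJ.
have lP := level_cells (marks_meshP XP).2.
have [_ _ [m' [k' [Mm' lm' lk' nm']]]] := marking_near p_ge1 XP.
have lk : l = k by move: lP; rewrite level_parent lm => lP; lia.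
have sS : side k%:Z = 2 * side k.+1%:Z.
  by rewrite side_succ; congr (_ * side _); lia.
apply: le_trans (funding_mono Q i'i).
apply: (IH i' i'i m' k') => //; first by lia.
  by have := divr_gt0 sk sL; lra.
have mm' : near (radius R p * side k.+1%:Z) m m'.
  apply: near_trans (near_parent R m) nm' _.
  by rewrite lm lk sS /reach /radius; lra.
apply: near_trans nm mm' _.
have E (x y z : R) : z != 0 ->
    x * (1 - e) * z + x * y = x * (1 - (e - y / z)) * z by move=> z0; field.
by rewrite E ?gt_eqF.
Qed.

Lemma funding_refined (Q : cell) : all_refined J Q -> 1 / 2 <= funding J Q.
Proof.
case=> i iJ [l XQ].
have lQ := level_cells (marks_meshP XQ).2.
have [_ _ [m [k [Mm lm lk nm]]]] := marking_near p_ge1 XQ.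
apply: le_trans (funding_mono Q iJ).
apply: (funding_chain lQ iJ Mm lm lk) => //.
apply: near_le nm _; rewrite ler_pM2r ?side_gt0// /reach /radius.
by have := ler0n R p; lra.
Qed.

(** Double counting of the shares: each refined cell receives at least 1/2, and
    each marked cell gives at most 2 (4 p + 4)^d. *)
Lemma card_all_refined :
  (ncard (all_refined J))%:R <=
  4 * ((4 * p + 4) ^ d)%:R * \sum_(0 <= j < J) (ncard (M j))%:R :> R.
Proof.
set N : R := ((4 * p + 4) ^ d)%:R.
set a := fset_set (all_refined J).
have aP Q : Q \in a -> all_refined J Q.
  by rewrite in_fset_set ?inE//; exact: finite_all_refined.
suff : (#|` a|)%:R * (1 / 2) <= \sum_(0 <= j < J) (ncard (M j))%:R * (2 * N) :> R.
  by rewrite -mulr_suml /ncard -/a; lra.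
apply: (@le_trans _ _ (\sum_(Q <- a) funding J Q)).
  rewrite mulr_natl -[#|` a|]count_predT -iter_addr_0 -big_const_seq.
  by rewrite big_seq [leRHS]big_seq; apply: ler_sum => Q /aP/funding_refined.
rewrite /funding exchange_big/=; apply: ler_sum_nat => j /andP[_ jJ].
rewrite exchange_big/= mulr_natl /ncard -[#|` fset_set (M j)|]count_predT.
rewrite -iter_addr_0 -big_const_seq.
rewrite big_seq [leRHS]big_seq; apply: ler_sum => m.
rewrite in_fset_set ?inE; last exact: finite_marked.
move=> /(M_mesh jJ)/mesh_cells[k /level_cells lm].
apply: sum_share lm; first exact: fset_uniq.
move=> Q /aP[i _ [l /marks_meshP[_ /level_cells lQ]]].
by exists l.
Qed.

End RefinementSequence.

Theorem theorem3p13 (R : realType) (d p : nat) (d_ge1 : (1 <= d)%N)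
    (p_ge1 : (1 <= p)%N) :
  let Ctilde : R := 3 / 2 * Num.sqrt d%:R * (2 * p + 1)%:R in
  exists C : R, C <= 4 * (4 * Ctilde + 1) ^+ d /\
    forall (J : nat) (H : nat -> hierarchy R d) (M : nat -> set (cell d)),
      H 0%N = initial R d ->
      (forall j, (j < J)%N -> M j `<=` mesh (H j)) ->
      (forall j, (j < J)%N -> H j.+1 =
         refine (H j) (weakly_admissible_marking_recursive p (H j) (M j))) ->
      (ncard (mesh (H J)))%:R - (ncard (mesh (H 0%N)))%:R
        <= C * \sum_(0 <= j < J) (ncard (M j))%:R.
Proof.
move=> Ctilde; exists (4 * (8 * p%:R + 8) ^+ d); split.
  have s1 : 1 <= Num.sqrt d%:R :> R by rewrite -[leLHS]sqrtr1 ler_wsqrtr// ler1n.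
  have p1 : 1 <= p%:R :> R by rewrite ler1n.
  have Ctilde_ge : 3 / 2 * (2 * p%:R + 1) <= Ctilde.
    by rewrite /Ctilde natrD natrM; nra.
  by rewrite ler_pM2l// lerXn2r ?nnegrE; lra.
move=> J H M H0 HM HS.
have := card_mesh_refined p_ge1 H0 HS (leqnn J).
have := card_all_refined p_ge1 H0 HM HS.
set a := ncard (all_refined _ _ _ _); set S := \sum_(_ <= _ < _) _ => refined_le.
rewrite -(ler_nat R) !natrD natrM natrX => mesh_le.
have -> : 8 * p%:R + 8 = 2 * (4 * p + 4)%:R :> R by rewrite natrD natrM; lra.
apply: (@le_trans _ _ (a%:R * 2 ^+ d)); first by have := ler0n R a; lra.
rewrite exprMn -[(4 * p + 4)%:R ^+ d]natrX [2 ^+ d * _]mulrC.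
by rewrite mulrA mulrAC ler_wpM2r// exprn_ge0.
Qed.
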